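(* Let $T=U|T|\in\mathcal{M}_m(\mathbb{C})$ be an invertible and centered $m\times m$ complex matrix, and let $\mathfrak{m}_f$ be an operator mean with representing function $f$ satisfying $f(x)\le 1-\lambda+\lambda x$ for all $x>0$, where $\lambda:=f'(1)\in(0,1)$. Then the sequence $\{\Delta_{\mathfrak{m}_f}^n(T)\}$ converges to a normal matrix as $n\to\infty$.
   Context: $|T|=(T^*T)^{1/2}$; for invertible $T$ the factor $U$ in the polar decomposition $T=U|T|$ is unitary. Operator mean: $\mathfrak{m}_f$ corresponds to a representing function $f:(0,\infty)\to(0,\infty)$, operator monotone with $f(1)=1$; for positive invertible $A,B$, $\mathfrak{m}_f(A,B)=A^{1/2}f(A^{-1/2}BA^{-1/2})A^{1/2}$. Induced Aluthge transformation: for invertible $T=U|T|$ with spectral decomposition $|T|=\int_{\sigma(|T|)}s\,dE_s$, define $\Delta_{\mathfrak{m}_f}(T)=\Delta_f(T):=\int_{\sigma(|T|)}\int_{\sigma(|T|)} s f(t/s)\,dE_s\,U\,dE_t$; for a matrix with $|T|=\sum_i s_iE_i$ ($s_i$ distinct eigenvalues, $E_i$ spectral projections) this is $\Delta_f(T)=\sum_{i,j}s_i f(s_j/s_i)E_iUE_j$. Iterates: $\Delta_f^0(T)=T$, $\Delta_f^n(T)=\Delta_f(\Delta_f^{n-1}(T))$. $T=U|T|$ is centered if $\{U^{*m}|T|U^m,\ |T|,\ U^n|T|U^{*n}: n,m=1,2,\dots\}$ is a commuting set. *)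

(* Defs.v *)
From HB Require Import structures.
From mathcomp Require Import all_boot all_order all_algebra.
From mathcomp Require Import complex.
From mathcomp Require Import all_classical all_reals all_analysis.

Set Implicit Arguments.
Unset Strict Implicit.
Unset Printing Implicit Defensive.

Import Order.TTheory GRing.Theory Num.Theory.
Import numFieldNormedType.Exports.

Local Open Scope ring_scope.
Local Open Scope complex_scope.
Local Open Scope sesquilinear_scope.

(* Functional calculus g(A) for a Hermitian matrix A and a real function g.
   The entries of [spectral_diag A] are then real, so taking [complex.Re]
   loses nothing. *)
Definition mxfun (R : realType) (n : nat) (g : R -> R) (A : 'M[R[i]]_n) :
    'M[R[i]]_n :=
  invmx (spectralmx A)
  *m diag_mx (map_mx (fun z : R[i] => (g (complex.Re z))%:C) (spectral_diag A))
  *m spectralmx A.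

(* The distinct eigenvalues of a Hermitian matrix. *)
Definition mxspec (R : realType) (n : nat) (A : 'M[R[i]]_n) : seq R :=
  undup [seq complex.Re (spectral_diag A 0 j) | j <- enum 'I_n].

(* The spectral projection of a Hermitian matrix A onto ker (A - s). *)
Definition spectral_proj (R : realType) (n : nat) (A : 'M[R[i]]_n) (s : R) :
    'M[R[i]]_n :=
  mxfun (fun x => (x == s)%:R) A.

Definition possemidefmx (R : realType) (n : nat) (A : 'M[R[i]]_n) : Prop :=
  A \is hermsymmx /\ forall v : 'rV[R[i]]_n, 0 <= (v *m A *m v^t*) 0 0.

Definition loewner_le (R : realType) (n : nat) (A B : 'M[R[i]]_n) : Prop :=
  possemidefmx (B - A).

(* Only the values of f on the positive half-line matter, here and below. *)
Definition operator_monotone (R : realType) (f : R -> R) : Prop :=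
  forall (n : nat) (A B : 'M[R[i]]_n),
    possemidefmx A -> A \in unitmx -> possemidefmx B -> B \in unitmx ->
    loewner_le A B -> loewner_le (mxfun f A) (mxfun f B).

(* Operator means (in the sense of Kubo and Ando) are identified with their
   representing functions. *)
Definition representing_function (R : realType) (f : R -> R) : Prop :=
  [/\ forall x, 0 < x -> 0 < f x, operator_monotone f & f 1 = 1].

Definition absmx (R : realType) (n : nat) (T : 'M[R[i]]_n) : 'M[R[i]]_n :=
  mxfun (@Num.sqrt R) (T^t* *m T).

(* The factor U of the polar decomposition T = U |T|, for T invertible. *)
Definition polarmx (R : realType) (n : nat) (T : 'M[R[i]]_n) : 'M[R[i]]_n :=
  T *m invmx (absmx T).

Definition aluthge (R : realType) (n : nat) (f : R -> R) (T : 'M[R[i]]_n) :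
    'M[R[i]]_n :=
  \sum_(s <- mxspec (absmx T)) \sum_(t <- mxspec (absmx T))
    (s * f (t / s))%:C *:
      (spectral_proj (absmx T) s *m polarmx T *m spectral_proj (absmx T) t).

Definition centered_family (R : realType) (n : nat) (T : 'M[R[i]]_n) :
    set 'M[R[i]]_n :=
  [set X | [\/ exists2 k : nat, (0 < k)%N &
                 X = (polarmx T)^t* ^+ k *m absmx T *m polarmx T ^+ k,
               X = absmx T
             | exists2 k : nat, (0 < k)%N &
                 X = polarmx T ^+ k *m absmx T *m (polarmx T)^t* ^+ k]].

Definition centered (R : realType) (n : nat) (T : 'M[R[i]]_n) : Prop :=
  forall X Y : 'M[R[i]]_n,
    centered_family T X -> centered_family T Y -> comm_mx X Y.

(* Main.v *)
(**
Writing T = U P with U unitary and P positive, centeredness makes the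
conjugates U^{*k} P U^k (k >= 0) commute, and then Delta_f(T) = U Q, where Q is
the mean m_f of the commuting matrices U^* P U and P; moreover the conjugates
of Q commute again.  So the unitary factor never changes, and the hypothesis on
f gives
  P_{n+1} = (1 - lambda) U^* P_n U + lambda P_n - E_n   with E_n >= 0.
In an orthonormal eigenbasis of U with eigenvalues d_i, the (i, j) entry
satisfies y_{n+1} = ((1 - lambda) conj(d_i) d_j + lambda) y_n - e_n.  On the
diagonal the multiplier is 1, so diagonal entries decrease, and
|e_ij| <= (e_ii + e_jj) / 2 is bounded by a telescoping sequence.  Off the
diagonal the multiplier is either 1 or of modulus < 1, so every entry
converges, to 0 unless d_i = d_j.  Hence P_n tends to a Hermitian matrix L
commuting with U, and U L is normal.
*)
Require Import Defs.
From HB Require Import structures.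
From mathcomp Require Import all_boot all_order all_algebra.
From mathcomp Require Import complex ring lra.
From mathcomp Require Import all_classical all_reals all_analysis.

Set Implicit Arguments.
Unset Strict Implicit.
Unset Printing Implicit Defensive.

Import Order.TTheory GRing.Theory Num.Theory.
Import numFieldNormedType.Exports.

Local Open Scope classical_set_scope.
Local Open Scope ring_scope.
Local Open Scope complex_scope.
Local Open Scope sesquilinear_scope.

(** * Perturbed scalar recurrences *)

Lemma nonincreasing_ge_cvgn (R : realType) (u : nat -> R) (c : R) :
  (forall n, u n.+1 <= u n) -> (forall n, c <= u n) -> cvgn u.
Proof.
move=> u_dec u_ge; apply: nonincreasing_is_cvgn.
  by apply/nonincreasing_seqP.
by exists c => _ [n _ <-].
Qed.

(* Both [s] and [x + s] are nonincreasing and bounded below. *)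
Lemma cvgn_bounded_variation (R : realType) (x s : nat -> R) :
  (forall n, 0 <= s n) -> (forall n, `|x n.+1 - x n| <= s n - s n.+1) ->
  cvgn x.
Proof.
move=> s_ge0 xs.
have s_dec n : s n.+1 <= s n by rewrite -subr_ge0 (le_trans _ (xs n)).
have x_ge n : x 0%N - s 0%N + s n <= x n.
  elim: n => [|n IHn]; first by rewrite subrK.
  by have := xs n; rewrite ler_norml => /andP[? _]; lra.
have cvg_s : cvgn s by exact: (nonincreasing_ge_cvgn s_dec s_ge0).
have cvg_xs : cvgn (fun n => x n + s n).
  apply: (@nonincreasing_ge_cvgn _ _ (x 0%N - s 0%N)) => n.
    by have := xs n; rewrite ler_norml => /andP[_ ?]; lra.
  by have := x_ge n; have := s_ge0 n; lra.
have -> : x = (fun n => x n + s n) - s by apply/funext => n /=; rewrite addrK.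
exact: is_cvgB.
Qed.

(* [b + s] is nonincreasing, so [b] has a limit, which is at most [q] times
   itself. *)
Lemma cvgn0_contraction (R : realType) (q : R) (b s : nat -> R) :
  q < 1 -> (forall n, 0 <= b n) -> (forall n, 0 <= s n) ->
  (forall n, s n.+1 <= s n) ->
  (forall n, b n.+1 <= q * b n + (s n - s n.+1)) -> b @ \oo --> 0.
Proof.
move=> q_lt1 b_ge0 s_ge0 s_dec b_le.
have cvg_s : cvgn s by exact: (nonincreasing_ge_cvgn s_dec s_ge0).
have cvg_bs : cvgn (fun n => b n + s n).
  apply: (@nonincreasing_ge_cvgn _ _ 0) => n; last by rewrite addr_ge0.
  by have := b_le n; have := b_ge0 n; nra.
have cvg_b : cvgn b.
  have -> : b = (fun n => b n + s n) - s by apply/funext => n /=; rewrite addrK.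
  exact: is_cvgB.
suff <- : limn b = 0 by [].
have cvg_bS : (fun n => b n.+1) @ \oo --> limn b.
  by rewrite -(cvg_shiftS b) in cvg_b *.
have cvg_sS : (fun n => s n.+1) @ \oo --> limn s.
  by rewrite (cvg_shiftS s).
have lim_ge0 : 0 <= limn b by apply: limr_ge => //; apply: nearW.
have lim_le : limn b <= q * limn b + (limn s - limn s).
  apply: (ler_cvg_to cvg_bS _ (nearW _ b_le)).
  apply: cvgD; last exact: cvgB cvg_s cvg_sS.
  by apply: cvgM => //; apply: cvg_cst.
by apply/eqP; rewrite eq_le lim_ge0 andbT; nra.
Qed.

Lemma normc_le_ReIm (R : rcfType) (z : R[i]) :
  `|z| <= (`|complex.Re z| + `|complex.Im z|)%:C.
Proof.
rewrite [z in leLHS]complexE (le_trans (ler_normD _ _))// normrM complexiE.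
by rewrite normCi mul1r !normc_def /= expr0n !addr0 !sqrtr_sqr -rmorphD.
Qed.

Lemma cvgn_complex (R : realType) (y : nat -> R[i]) :
  cvgn (fun n => complex.Re (y n)) -> cvgn (fun n => complex.Im (y n)) ->
  exists l : R[i], (y : nat -> (R[i])^o) @ \oo --> (l : (R[i])^o).
Proof.
move=> /cvg_ex[a /= /cvgrPdist_lt ya] /cvg_ex[b /= /cvgrPdist_lt yb].
exists (a +i* b); apply/cvgrPdist_lt => e e_gt0.
(* A positive element of [R[i]] is real, so the tolerance can be replaced by its real part and split
   evenly between the two coordinates. *)
have e_real := RRe_real (gtr0_real e_gt0).
have e2_gt0 : 0 < complex.Re e / 2.
  by rewrite divr_gt0// -(ltcR 0) e_real.
near=> n.
rewrite (le_lt_trans (normc_le_ReIm _))// -e_real ltcR.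
rewrite !raddfB /= (splitr (complex.Re e)) ltrD//; near: n.
  exact: ya.
exact: yb.
Unshelve. all: by end_near. Qed.

Lemma normc_ReK (R : realType) (z : R[i]) : (complex.Re `|z|)%:C = `|z|.
Proof. by rewrite RRe_real// normr_real. Qed.

(** The point lies strictly inside the chord of the unit circle from [z] to [1]. Its squared modulus
    is [1 - 2 * lam * (1 - lam) * (1 - Re z)], and [Re z < 1] because [z] differs from [1]. *)
Lemma Re_norm_lt1 (R : realType) (lam : R) (z : R[i]) :
  0 < lam < 1 -> `|z| = 1 -> z != 1 ->
  complex.Re `|(1 - lam)%:C * z + lam%:C| < 1.
Proof.
move=> /andP[lam_gt0 lam_lt1]; case: z => a b z1 neq1.
have ab1 : a ^+ 2 + b ^+ 2 = 1.
  by apply: complexI; rewrite (add_Re2_Im2 (a +i* b)) z1 expr1n.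
have a_lt1 : a < 1.
  rewrite lt_neqAle; apply/andP; split; last first.
    by have := sqr_ge0 b; nra.
  apply: contra neq1 => /eqP a1; rewrite eq_complex /= a1 eqxx /=.
  by rewrite -sqrf_eq0; apply/eqP; rewrite a1 in ab1; lra.
rewrite normc_def /= -[ltRHS]sqrtr1 ltr_sqrt//.
rewrite !mul0r !subr0 !addr0.
have -> : ((1 - lam) * a + lam) ^+ 2 + ((1 - lam) * b) ^+ 2 =
  (1 - lam) ^+ 2 * (a ^+ 2 + b ^+ 2) + lam ^+ 2 + 2 * lam * (1 - lam) * a.
  by ring.
have : 0 < lam * ((1 - lam) * (1 - a)) by rewrite !mulr_gt0// subr_gt0.
by rewrite ab1; nra.
Qed.

(** If [z = 1] the multiplier is [1] and [y] has bounded variation; otherwise the multiplier is a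
    strict contraction and the limit is [0]. The equation [z * l = l] records both cases at once, in
    the form that later yields commutation with [U]. *)
Lemma cvgn_perturbed_rotation (R : realType) (lam : R) (z : R[i])
    (y : nat -> R[i]) (s : nat -> R) :
  0 < lam < 1 -> `|z| = 1 -> (forall n, 0 <= s n) ->
  (forall n, `|y n.+1 - ((1 - lam)%:C * z + lam%:C) * y n|
             <= (s n - s n.+1)%:C) ->
  exists2 l : R[i], (y : nat -> (R[i])^o) @ \oo --> (l : (R[i])^o) & z * l = l.
Proof.
move=> lam01 z1 s_ge0 y_le.
have s_dec n : s n.+1 <= s n.
  by rewrite -subr_ge0 -ler0c (le_trans _ (y_le n)).
have [zE|z_neq1] := eqVneq z 1.
  suff [l yl] : exists l : R[i],
      (y : nat -> (R[i])^o) @ \oo --> (l : (R[i])^o).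
    by exists l; rewrite // zE mul1r.
  have y_var n : `|y n.+1 - y n| <= (s n - s n.+1)%:C.
    have := y_le n; rewrite zE mulr1 -rmorphD.
    by rewrite subrK mul1r.
  apply: cvgn_complex; apply: (cvgn_bounded_variation s_ge0) => n.
    rewrite -lecR (le_trans _ (y_var n))//.
    by rewrite -raddfB normc_ge_Re.
  rewrite -lecR (le_trans _ (y_var n))//.
  rewrite -raddfB /=; case: (_ - _) => u v /=; rewrite normc_def lecR /=.
  by rewrite -sqrtr_sqr ler_sqrt ?addr_ge0 ?sqr_ge0// lerDr sqr_ge0.
exists 0; last by rewrite mulr0.
set w := (1 - lam)%:C * z + lam%:C in y_le.
have : (fun n => complex.Re `|y n|) @ \oo --> (0 : R).
  apply: (@cvgn0_contraction _ (complex.Re `|w|) _ s) => // [|n|n].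
  - exact: Re_norm_lt1.
  - by rewrite -ler0c normc_ReK.
  rewrite -lecR rmorphD rmorphM /= !normc_ReK -normrM.
  rewrite -[y n.+1](subrK (w * y n)) addrC.
  by rewrite (le_trans (ler_normD _ _))// lerD2l.
move=> /cvgrPdist_lt yl; apply/cvgrPdist_lt => e e_gt0.
have e_real := RRe_real (gtr0_real e_gt0).
have {}e_gt0 : 0 < complex.Re e by rewrite -(ltcR 0) e_real.
near=> n; rewrite sub0r normrN -normc_ReK -e_real ltcR.
rewrite -[ltLHS]ger0_norm -?ler0c ?normc_ReK// -normrN -sub0r.
by near: n; exact: yl.
Unshelve. all: by end_near. Qed.

(** * Functional calculus of normal matrices *)

Lemma adjmxM (C : numClosedFieldType) m n p (A : 'M[C]_(m, n))
    (B : 'M[C]_(n, p)) : (A *m B)^t* = B^t* *m A^t*.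
Proof. by rewrite trmx_mul map_mxM. Qed.

Lemma adjmx1 (C : numClosedFieldType) n : (1%:M : 'M[C]_n)^t* = 1%:M.
Proof. by rewrite trmx1 map_mx1. Qed.

Lemma unitarymx_adjM (C : numClosedFieldType) n (U : 'M[C]_n) :
  U \is unitarymx -> U^t* *m U = 1%:M.
Proof. by rewrite -trmxC_unitary => /unitarymxP; rewrite trmxCK. Qed.

Lemma selfadj_normal (C : numClosedFieldType) n (A : 'M[C]_n) :
  A^t* = A -> A \is normalmx.
Proof. by move=> adjA; apply/normalmxP; rewrite adjA. Qed.

(** The assumption reads entrywise [M i j * (a j - b i) = 0]: wherever [M i j] is nonzero, [a j] and
    [b i] coincide, hence so do their images under an arbitrary [g]. *)
Lemma diag_mx_intertwine (K : idomainType) m n (g : K -> K)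
    (M : 'M[K]_(m, n)) (a : 'rV[K]_n) (b : 'rV[K]_m) :
  M *m diag_mx a = diag_mx b *m M ->
  M *m diag_mx (map_mx g a) = diag_mx (map_mx g b) *m M.
Proof.
move=> /matrixP Mab; apply/matrixP => i j.
have := Mab i j; rewrite !mul_mx_diag !mul_diag_mx !mxE [RHS]mulrC.
have [->|Mij0] := eqVneq (M i j) 0; first by rewrite !mul0r mulr0.
by move=> /(mulfI Mij0) ->; rewrite mulrC.
Qed.

Definition conjmxU (C : numClosedFieldType) n (W A : 'M[C]_n) : 'M[C]_n :=
  W^t* *m A *m W.

Section ConjugationByUnitary.
Variables (C : numClosedFieldType) (n : nat).
Implicit Types (A B W : 'M[C]_n).

Lemma conjmxUM W A B : W \is unitarymx ->
  conjmxU W (A *m B) = conjmxU W A *m conjmxU W B.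
Proof. by move=> Wu; rewrite /conjmxU !mulmxA mulmxtVK. Qed.

Lemma conjmxU1 W : W \is unitarymx -> conjmxU W 1%:M = 1%:M.
Proof. by move=> Wu; rewrite /conjmxU mulmx1 unitarymx_adjM. Qed.

Lemma conjmxU_adj W A : (conjmxU W A)^t* = conjmxU W (A^t*).
Proof. by rewrite /conjmxU !adjmxM trmxCK mulmxA. Qed.

Lemma conjmxU_mul V W A : conjmxU V (conjmxU W A) = conjmxU (W *m V) A.
Proof. by rewrite /conjmxU adjmxM !mulmxA. Qed.

Lemma conjmxUZ W a A : conjmxU W (a *: A) = a *: conjmxU W A.
Proof. by rewrite /conjmxU -scalemxAr -scalemxAl. Qed.

Lemma conjmxUD W A B : conjmxU W (A + B) = conjmxU W A + conjmxU W B.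
Proof. by rewrite /conjmxU mulmxDr mulmxDl. Qed.

Lemma conjmxUN W A : conjmxU W (- A) = - conjmxU W A.
Proof. by rewrite /conjmxU mulmxN mulNmx. Qed.

Lemma conjmxU_sum W (I : Type) (r : seq I) (F : I -> 'M[C]_n) :
  conjmxU W (\sum_(i <- r) F i) = \sum_(i <- r) conjmxU W (F i).
Proof. by rewrite /conjmxU mulmx_sumr mulmx_suml. Qed.

End ConjugationByUnitary.

Definition spectral_fun (C : numClosedFieldType) n (G : C -> C)
    (A : 'M[C]_n) : 'M[C]_n :=
  conjmxU (spectralmx A) (diag_mx (map_mx G (spectral_diag A))).

Section SpectralFun.
Variables (C : numClosedFieldType) (n : nat).
Implicit Types (A S W X : 'M[C]_n) (G : C -> C).

Lemma conjmxUK W A : W \is unitarymx -> conjmxU W (conjmxU (W^t*) A) = A.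
Proof.
move=> Wu.
by rewrite conjmxU_mul unitarymx_adjM// /conjmxU adjmx1 mul1mx mulmx1.
Qed.

Lemma conjmxUKV W A : W \is unitarymx -> conjmxU (W^t*) (conjmxU W A) = A.
Proof.
by move=> Wu; rewrite conjmxU_mul (unitarymxP Wu) /conjmxU adjmx1 mul1mx mulmx1.
Qed.

Lemma normal_spectralE A : A \is normalmx ->
  A = conjmxU (spectralmx A) (diag_mx (spectral_diag A)).
Proof.
by move=> /orthomx_spectralP; rewrite invmx_unitary// spectral_unitarymx.
Qed.

(* An intertwiner of two diagonal matrices also intertwines their images under
   G, so the result does not depend on the chosen diagonalisation. *)
Lemma spectral_fun_diag G A W (a : 'rV[C]_n) : A \is normalmx ->
  W \is unitarymx -> A = conjmxU W (diag_mx a) ->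
  spectral_fun G A = conjmxU W (diag_mx (map_mx G a)).
Proof.
move=> /normal_spectralE specA Wu Adiag; rewrite /spectral_fun.
have Su := spectral_unitarymx A; set S := spectralmx A in Su specA *.
set b := spectral_diag A in specA *.
have : S *m W^t* *m diag_mx a = diag_mx b *m (S *m W^t*).
  transitivity (S *m A *m W^t*).
    by rewrite Adiag /conjmxU !mulmxA mulmxtVK.
  by rewrite {1}specA /conjmxU !mulmxA (unitarymxP Su) mul1mx.
move=> /(diag_mx_intertwine G) SW.
rewrite /conjmxU; set Ga := diag_mx _ in SW *; set Gb := diag_mx _ in SW *.
transitivity (S^t* *m (Gb *m (S *m W^t*)) *m W).
  by rewrite !mulmxA mulmxKtV.
by rewrite -SW !mulmxA unitarymx_adjM// mul1mx.
Qed.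

Lemma spectral_fun_conj G A W : A \is normalmx -> W \is unitarymx ->
  spectral_fun G (conjmxU W A) = conjmxU W (spectral_fun G A).
Proof.
move=> nA Wu; rewrite [in RHS]/spectral_fun conjmxU_mul.
apply: spectral_fun_diag.
- by apply/normalmxP; rewrite conjmxU_adj -!conjmxUM// (normalmxP nA).
- by rewrite mul_unitarymx// spectral_unitarymx.
- by rewrite -conjmxU_mul -normal_spectralE.
Qed.

(** In an eigenbasis of [A], commuting with [A] means intertwining its diagonal form with itself, a
    property that survives applying [G] to the diagonal. *)
Lemma comm_spectral_fun G A X : A \is normalmx -> comm_mx X A ->
  comm_mx X (spectral_fun G A).
Proof.
move=> /normal_spectralE specA XA; rewrite /spectral_fun.
have Su := spectral_unitarymx A; set S := spectralmx A in Su specA *.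
set a := spectral_diag A in specA *.
pose Y := conjmxU (S^t*) X; have YE : conjmxU S Y = X by rewrite conjmxUK.
have : Y *m diag_mx a = diag_mx a *m Y.
  have -> : diag_mx a = conjmxU (S^t*) A by rewrite specA conjmxUKV.
  by rewrite -!conjmxUM ?trmxC_unitary// XA.
move=> /(diag_mx_intertwine G) Ycomm.
by rewrite -YE /comm_mx -!conjmxUM// Ycomm.
Qed.

Lemma spectral_funM G H A :
  spectral_fun G A *m spectral_fun H A = spectral_fun (fun z => G z * H z) A.
Proof.
rewrite /spectral_fun -conjmxUM ?spectral_unitarymx// mulmx_diag.
by congr (conjmxU _ (diag_mx _)); apply/rowP => j; rewrite !mxE.
Qed.

Lemma spectral_fun_adj G A :
  (spectral_fun G A)^t* = spectral_fun (fun z => Num.conj (G z)) A.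
Proof.
rewrite /spectral_fun conjmxU_adj tr_diag_mx map_diag_mx.
by congr (conjmxU _ (diag_mx _)); apply/rowP => j; rewrite !mxE.
Qed.

Lemma eq_spectral_fun G H A :
  (forall j, G (spectral_diag A 0 j) = H (spectral_diag A 0 j)) ->
  spectral_fun G A = spectral_fun H A.
Proof.
move=> GH; congr (conjmxU _ (diag_mx _)).
by apply/rowP => j; rewrite !mxE GH.
Qed.

Lemma spectral_fun1 A : spectral_fun (fun=> 1) A = 1%:M.
Proof.
rewrite -(conjmxU1 (spectral_unitarymx A)); congr conjmxU.
by apply/matrixP => i j; rewrite !mxE.
Qed.

Lemma spectral_fun0 A : spectral_fun (fun=> 0) A = 0.
Proof.
rewrite /spectral_fun [X in diag_mx X](_ : _ = 0).
  by rewrite raddf0 /conjmxU mulmx0 mul0mx.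
by apply/rowP => j; rewrite !mxE.
Qed.

Lemma spectral_fun_id A : A \is normalmx -> spectral_fun id A = A.
Proof.
move=> nA; rewrite [RHS]normal_spectralE//.
by congr (conjmxU _ (diag_mx _)); apply/rowP => j; rewrite mxE.
Qed.

Lemma spectral_fun_comp G H A : spectral_fun H A \is normalmx ->
  spectral_fun G (spectral_fun H A) = spectral_fun (G \o H) A.
Proof.
move=> nHA.
rewrite (spectral_fun_diag G nHA (spectral_unitarymx A) (erefl _)).
by congr (conjmxU _ (diag_mx _)); apply/rowP => j; rewrite !mxE.
Qed.

Lemma spectral_fun_sqr A : A \is normalmx ->
  A *m A = spectral_fun (fun z => z * z) A.
Proof. by move=> nA; rewrite -spectral_funM !spectral_fun_id. Qed.

Lemma spectral_fun_sum (I : Type) (r : seq I) (c : I -> C) (G : I -> C -> C) A :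
  \sum_(i <- r) c i *: spectral_fun (G i) A =
  spectral_fun (fun z => \sum_(i <- r) c i * G i z) A.
Proof.
rewrite /spectral_fun; under eq_bigr do rewrite -conjmxUZ.
rewrite -conjmxU_sum; congr conjmxU.
apply/matrixP => i j; rewrite summxE !mxE -sumrMnl.
by apply: eq_bigr => k _; rewrite !mxE mulrnAr.
Qed.

Lemma spectral_diag_real A j : A^t* = A -> spectral_diag A 0 j \is Num.real.
Proof.
move=> adjA.
have /hermitian_spectral_diag_real/mxOverP : A \is hermsymmx.
  by apply/is_hermitianmxP; rewrite expr0 scale1r adjA.
by apply.
Qed.

End SpectralFun.

Section FunctionalCalculus.
Variables (R : realType) (n : nat).
Implicit Types (A W X : 'M[R[i]]_n) (g h c : R -> R) (s t : R).

Lemma mxfunE g A : mxfun g A = spectral_fun (fun z => (g (complex.Re z))%:C) A.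
Proof. by rewrite /mxfun invmx_unitary// spectral_unitarymx. Qed.

Lemma eq_mxfun g h A : {in mxspec A, g =1 h} -> mxfun g A = mxfun h A.
Proof.
move=> gh; rewrite !mxfunE; apply: eq_spectral_fun => j.
by rewrite gh// mem_undup; apply/mapP; exists j; rewrite ?mem_enum.
Qed.

Lemma mxfunM g h A :
  mxfun g A *m mxfun h A = mxfun (fun x => g x * h x) A.
Proof.
rewrite !mxfunE spectral_funM; apply: eq_spectral_fun => j.
by rewrite rmorphM.
Qed.

Lemma mxfun_adj g A : (mxfun g A)^t* = mxfun g A.
Proof.
rewrite mxfunE spectral_fun_adj; apply: eq_spectral_fun => j.
exact: conjc_real.
Qed.

Lemma mxfun1 A : mxfun (fun=> 1) A = 1%:M.
Proof. by rewrite mxfunE -(spectral_fun1 A); apply: eq_spectral_fun. Qed.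

Lemma mxfun_id A : A^t* = A -> mxfun id A = A.
Proof.
move=> adjA; rewrite mxfunE.
transitivity (spectral_fun id A).
  by apply: eq_spectral_fun => j; rewrite RRe_real// spectral_diag_real.
exact: spectral_fun_id (selfadj_normal adjA).
Qed.

Lemma spectral_projM A s t : spectral_proj A s *m spectral_proj A t =
  if s == t then spectral_proj A s else 0.
Proof.
rewrite mxfunM; have [<-|st] := eqVneq s t.
  by apply: eq_mxfun => x _; rewrite -natrM mulnb andbb.
rewrite mxfunE -(spectral_fun0 A); apply: eq_spectral_fun => j.
rewrite -natrM mulnb.
by have [->|] := eqVneq _ s; rewrite ?(negPf st).
Qed.

Lemma spectral_proj_sum c A :
  \sum_(s <- mxspec A) (c s)%:C *: spectral_proj A s = mxfun c A.
Proof.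
under eq_bigr do rewrite /spectral_proj mxfunE.
(* At a point of the spectrum exactly one indicator is nonzero, since [mxspec] lists each eigenvalue
   once. *)
rewrite spectral_fun_sum -(@eq_mxfun (fun x =>
  \sum_(s <- mxspec A) c s * (x == s)%:R)); last first.
  move=> x xA; rewrite (bigD1_seq x) ?undup_uniq//= eqxx mulr1 big1 ?addr0//.
  by move=> s sx; rewrite eq_sym (negPf sx) mulr0.
rewrite mxfunE; apply: eq_spectral_fun => j; rewrite rmorph_sum.
by apply: eq_bigr => s _; rewrite rmorphM.
Qed.

End FunctionalCalculus.

(** * Positive matrices and joint functional calculus *)

Lemma unitarymxX (C : numClosedFieldType) n (U : 'M[C]_n) k :
  U \is unitarymx -> U ^+ k \is unitarymx.
Proof.
move=> Uu; elim: k => [|k IHk]; last by rewrite exprS mul_unitarymx.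
by apply/unitarymxP; rewrite expr0 adjmx1 mulmx1.
Qed.

(* Positive semidefiniteness, in factored form. *)
Definition gram (C : numClosedFieldType) n (A : 'M[C]_n) :=
  exists B : 'M[C]_n, A = B^t* *m B.

Section Gram.
Variables (C : numClosedFieldType) (n : nat).
Implicit Types (A B W : 'M[C]_n).

Lemma gram_adj A : gram A -> A^t* = A.
Proof. by case=> B ->; rewrite adjmxM trmxCK. Qed.

Lemma gram_normal A : gram A -> A \is normalmx.
Proof. by move=> /gram_adj; exact: selfadj_normal. Qed.

Lemma gram_conj A W : gram A -> gram (conjmxU W A).
Proof. by case=> B ->; exists (B *m W); rewrite /conjmxU adjmxM !mulmxA. Qed.

Lemma gramE B i j :
  (B^t* *m B) i j = \sum_k Num.conj (B k i) * B k j.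
Proof. by rewrite mxE; apply: eq_bigr => k _; rewrite !mxE. Qed.

Lemma gram_diag_ge0 A i : gram A -> 0 <= A i i.
Proof.
case=> B ->; rewrite gramE sumr_ge0// => k _.
by rewrite mulrC mul_conjC_ge0.
Qed.

(** For [A = B^* B] this is the inequality of arithmetic and geometric means for [|B k i|] and
    [|B k j|], summed over [k]. It lets diagonal errors control the off-diagonal ones. *)
Lemma gram_offdiag A i j : gram A -> `|A i j| <= (A i i + A j j) / 2.
Proof.
case=> B ->; rewrite !gramE -big_split mulr_suml.
rewrite (le_trans (ler_norm_sum _ _ _))//.
apply: ler_sum => k _ /=; rewrite normrM norm_conjC.
rewrite ![Num.conj _ * _]mulrC -!normCK ler_pdivlMr// -subr_ge0.
rewrite [X in 0 <= X](_ : _ = (`|B k i| - `|B k j|) ^+ 2); last by ring.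
by rewrite -realEsqr rpredB// normr_real.
Qed.

(** The diagonalised matrix is again a Gram matrix, and the eigenvalues are its diagonal entries. *)
Lemma gram_spectral_diag_ge0 A j : gram A -> 0 <= spectral_diag A 0 j.
Proof.
move=> gA; have Su := spectral_unitarymx A.
have := gram_diag_ge0 j (gram_conj ((spectralmx A)^t*) gA).
by rewrite {2}(normal_spectralE (gram_normal gA)) conjmxUKV// mxE eqxx.
Qed.

Lemma spectral_diag_neq0 A j : A \is normalmx -> A \in unitmx ->
  spectral_diag A 0 j != 0.
Proof.
move=> /normal_spectralE specA; rewrite {1}specA /conjmxU !unitmx_mul.
move=> /andP[/andP[_]]; rewrite unitmxE det_diag unitfE => /prodf_neq0 + _.
by apply.
Qed.

End Gram.

Section JointCalculus.
Variables (C : numClosedFieldType) (n : nat) (I : eqType) (l : seq I).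
Implicit Types (E F : I -> 'M[C]_n) (g h : I -> I -> C) (a b : I -> C).

(** A resolution of the identity into orthogonal projections. The first two clauses range over all
    of [I]; together with the sum they force [E i = 0] for [i] outside [l], just as the spectral
    projection at a non-eigenvalue vanishes. *)
Definition resolution E :=
  [/\ forall i j, E i *m E j = if i == j then E i else 0,
      forall i, (E i)^t* = E i & \sum_(i <- l) E i = 1%:M].

(* The value at [g] of the joint functional calculus of two commuting matrices
   with spectral projections [E i] and [F j]. *)
Definition joint E F g :=
  \sum_(i <- l) \sum_(j <- l) g i j *: (E i *m F j).

Lemma resolution_conj E (W : 'M[C]_n) : W \is unitarymx ->
  resolution E -> resolution (fun i => conjmxU W (E i)).
Proof.
move=> Wu [EM Eadj Esum]; split=> [i j|i|].
- by rewrite -conjmxUM// EM; case: ifP => // _; rewrite /conjmxU mulmx0 mul0mx.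
- by rewrite conjmxU_adj Eadj.
- by rewrite -conjmxU_sum Esum conjmxU1.
Qed.

Lemma joint_prod E F a b : joint E F (fun i j => a i * b j) =
  (\sum_(i <- l) a i *: E i) *m (\sum_(j <- l) b j *: F j).
Proof.
rewrite mulmx_suml; apply: eq_bigr => i _.
rewrite mulmx_sumr; apply: eq_bigr => j _.
by rewrite -scalemxAl -scalemxAr scalerA.
Qed.

Lemma eq_joint E F g h : {in l &, forall i j, g i j = h i j} ->
  joint E F g = joint E F h.
Proof.
by move=> gh; apply: eq_big_seq => i il; apply: eq_big_seq => j jl; rewrite gh.
Qed.

Lemma jointD E F g h :
  joint E F (fun i j => g i j + h i j) = joint E F g + joint E F h.
Proof.
rewrite -big_split; apply: eq_bigr => i _ /=.
by rewrite -big_split; apply: eq_bigr => j _ /=; rewrite scalerDl.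
Qed.

Lemma jointN E F g : joint E F (fun i j => - g i j) = - joint E F g.
Proof.
rewrite -sumrN; apply: eq_bigr => i _.
by rewrite -sumrN; apply: eq_bigr => j _; rewrite scaleNr.
Qed.

Lemma jointZ E F c g : joint E F (fun i j => c * g i j) = c *: joint E F g.
Proof.
rewrite scaler_sumr; apply: eq_bigr => i _.
by rewrite scaler_sumr; apply: eq_bigr => j _; rewrite scalerA.
Qed.

Section Commuting.
Variables E F : I -> 'M[C]_n.
Hypotheses (l_uniq : uniq l) (resE : resolution E) (resF : resolution F).
Hypothesis EFcomm : forall i j, comm_mx (E i) (F j).

Lemma joint1 : joint E F (fun _ _ => 1) = 1%:M.
Proof.
have [_ _ E1] := resE; have [_ _ F1] := resF.
transitivity (joint E F (fun _ _ => 1 * 1)).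
  by apply: eq_joint => i j _ _; rewrite mulr1.
rewrite (joint_prod _ _ (fun=> 1) (fun=> 1)).
under eq_bigr do rewrite scale1r; under [X in _ *m X]eq_bigr do rewrite scale1r.
by rewrite E1 F1 mulmx1.
Qed.

(** Since the two families commute, the products [E i *m F j] are mutually orthogonal idempotents,
    so only equal index pairs survive; [l_uniq] makes each pair occur once. *)
Lemma jointM g h :
  joint E F g *m joint E F h = joint E F (fun i j => g i j * h i j).
Proof.
have [EM _ _] := resE; have [FM _ _] := resF.
have EFM i j i' j' : (E i *m F j) *m (E i' *m F j') =
    if (i == i') && (j == j') then E i *m F j else 0.
  rewrite mulmxA -(mulmxA (E i)) -EFcomm mulmxA -mulmxA EM FM.
  by case: eqP; case: eqP; rewrite ?mulmx0 ?mul0mx.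
rewrite mulmx_suml; apply: eq_big_seq => i il.
rewrite mulmx_suml; apply: eq_big_seq => j jl.
rewrite mulmx_sumr (bigD1_seq i)//= [X in _ + X]big1 => [|i' ii']; last first.
  rewrite mulmx_sumr big1// => j' _.
  by rewrite -scalemxAl -scalemxAr EFM eq_sym (negPf ii') !scaler0.
rewrite addr0 mulmx_sumr (bigD1_seq j)//= [X in _ + X]big1 => [|j' jj'].
  by rewrite addr0 -scalemxAl -scalemxAr EFM !eqxx scalerA.
by rewrite -scalemxAl -scalemxAr EFM eqxx eq_sym (negPf jj') !scaler0.
Qed.

Lemma joint_adj g :
  (joint E F g)^t* = joint E F (fun i j => Num.conj (g i j)).
Proof.
have [_ Eadj _] := resE; have [_ Fadj _] := resF.
rewrite /joint raddf_sum map_mx_sum; apply: eq_bigr => i _.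
rewrite raddf_sum map_mx_sum; apply: eq_bigr => j _.
by rewrite /= linearZ map_mxZ adjmxM Eadj Fadj EFcomm.
Qed.

Lemma gram_joint g : {in l &, forall i j, 0 <= g i j} -> gram (joint E F g).
Proof.
(* The Gram factor is the pointwise square root, which is real and hence gives a self-adjoint
   matrix. *)
move=> g_ge0; exists (joint E F (fun i j => sqrtC (g i j))).
rewrite joint_adj jointM; apply: eq_joint => i j il jl.
by rewrite conj_Creal ?ger0_real ?sqrtC_ge0 ?g_ge0// -expr2 sqrtCK.
Qed.

Lemma joint_unitmx g : {in l &, forall i j, g i j != 0} ->
  joint E F g \in unitmx.
Proof.
move=> g_neq0; suff: joint E F g *m joint E F (fun i j => (g i j)^-1) = 1%:M.
  by move=> /mulmx1_unit[].
rewrite jointM -joint1; apply: eq_joint => i j il jl.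
by rewrite divff// g_neq0.
Qed.

End Commuting.
End JointCalculus.

Section OrbitCommutation.
Variables (C : numClosedFieldType) (n : nat).
Implicit Types (A U : 'M[C]_n) (G H : C -> C).

(** The form in which centeredness is carried along the iteration, with [U] fixed and [A] the
    current positive factor. *)
Definition orbit_commutes U A := forall j k : nat,
  comm_mx (conjmxU (U ^+ j) A) (conjmxU (U ^+ k) A).

(** Functional calculus passes through unitary conjugation, so [comm_spectral_fun] can be applied to
    each side in turn. *)
Lemma orbit_commutes_spectral_fun U A G H j k : U \is unitarymx ->
  A \is normalmx -> orbit_commutes U A ->
  comm_mx (conjmxU (U ^+ j) (spectral_fun G A))
          (conjmxU (U ^+ k) (spectral_fun H A)).
Proof.
move=> Uu nA UA.
have Uku m : U ^+ m \is unitarymx by exact: unitarymxX.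
have nAk m : conjmxU (U ^+ m) A \is normalmx.
  by apply/normalmxP; rewrite conjmxU_adj -!conjmxUM// (normalmxP nA).
rewrite -!spectral_fun_conj//; apply: comm_spectral_fun (nAk k) _.
by apply/comm_mx_sym/(comm_spectral_fun _ (nAk j))/UA.
Qed.

Variables (I : eqType) (l : seq I) (F : I -> 'M[C]_n) (g : I -> I -> C).

(** As [U U^* = 1], the leading [U] cancels the adjoint in each conjugated projection. This turns
    the double sum defining the Aluthge transform into [U] times a joint functional calculus. *)
Lemma mul_joint_conj U : U \is unitarymx ->
  U *m joint l (fun i => conjmxU U (F i)) F g =
  \sum_(i <- l) \sum_(j <- l) g i j *: (F i *m U *m F j).
Proof.
move=> Uu; rewrite mulmx_sumr; apply: eq_bigr => i _.
rewrite mulmx_sumr; apply: eq_bigr => j _.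
by rewrite -scalemxAr /conjmxU !mulmxA (unitarymxP Uu) mul1mx.
Qed.

Lemma orbit_commutes_joint U : U \is unitarymx ->
  (forall j k s t, comm_mx (conjmxU (U ^+ j) (F s)) (conjmxU (U ^+ k) (F t))) ->
  orbit_commutes U (joint l (fun i => conjmxU U (F i)) F g).
Proof.
move=> Uu UF.
(* Conjugation only shifts exponents. The first family already carries one conjugation by [U], hence
   [k.+1] there and [k] in the second. *)
have jointE k : conjmxU (U ^+ k) (joint l (fun i => conjmxU U (F i)) F g) =
    joint l (fun i => conjmxU (U ^+ k.+1) (F i))
            (fun i => conjmxU (U ^+ k) (F i)) g.
  rewrite /joint conjmxU_sum; apply: eq_bigr => s _.
  rewrite conjmxU_sum; apply: eq_bigr => t _.
  by rewrite conjmxUZ conjmxUM ?unitarymxX// conjmxU_mul exprS.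
have comm_joint X m : (forall k t, comm_mx X (conjmxU (U ^+ k) (F t))) ->
    comm_mx X (joint l (fun i => conjmxU (U ^+ m.+1) (F i))
                       (fun i => conjmxU (U ^+ m) (F i)) g).
  move=> XF; apply: comm_mx_sum => s _; apply: comm_mx_sum => t _.
  rewrite -mul_scalar_mx.
  by apply: comm_mxM; [exact: comm_mx_scalar|apply: comm_mxM; exact: XF].
move=> j k; rewrite !jointE; apply: (comm_joint) => k0 t.
by apply/comm_mx_sym/comm_joint => k'' s; exact: UF.
Qed.

End OrbitCommutation.

(** * One step of the Aluthge iteration *)

Section AluthgeStep.
Variables (R : realType) (n : nat).
Implicit Types (P Q T U : 'M[R[i]]_n).

Lemma mxspec_gram_gt0 P s : gram P -> P \in unitmx -> s \in mxspec P -> 0 < s.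
Proof.
move=> gP Pu; rewrite mem_undup => /mapP[j _ ->].
have := gram_spectral_diag_ge0 j gP.
have := spectral_diag_neq0 j (gram_normal gP) Pu.
move=> d_neq0; rewrite le0r (negPf d_neq0) /=.
by rewrite ltcE => /andP[].
Qed.

Lemma mxspec_gram_ge0 P s : gram P -> s \in mxspec P -> 0 <= s.
Proof.
move=> gP; rewrite mem_undup => /mapP[j _ ->].
by have := gram_spectral_diag_ge0 j gP; rewrite lecE => /andP[].
Qed.

Lemma spectral_proj_resolution P : resolution (mxspec P) (spectral_proj P).
Proof.
split=> [s t|s|]; [exact: spectral_projM|exact: mxfun_adj|].
rewrite -(mxfun1 P) -(spectral_proj_sum (fun=> 1)).
by under [RHS]eq_bigr do rewrite scale1r.
Qed.

Lemma gram_absmx T : gram (absmx T).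
Proof.
(* The Gram factor is the self-adjoint fourth root of [T^* T]. *)
exists (mxfun (fun x => Num.sqrt (Num.sqrt x)) (T^t* *m T)).
rewrite mxfun_adj mxfunM; apply: eq_mxfun => x _.
by rewrite -expr2 sqr_sqrtr ?sqrtr_ge0.
Qed.

Lemma absmx_sqr T : absmx T *m absmx T = T^t* *m T.
Proof.
have gT : gram (T^t* *m T) by exists T.
rewrite mxfunM -[RHS](mxfun_id (gram_adj gT)); apply: eq_mxfun => x xT.
by rewrite -expr2 sqr_sqrtr ?(mxspec_gram_ge0 gT).
Qed.

Lemma absmx_unit T : T \in unitmx -> absmx T \in unitmx.
Proof.
move=> Tu; suff: absmx T *m absmx T \in unitmx.
  by rewrite unitmx_mul => /andP[].
by rewrite absmx_sqr unitmx_mul map_unitmx unitmx_tr Tu.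
Qed.

Lemma polar_decomposition T : T \in unitmx -> T = polarmx T *m absmx T.
Proof. by move=> Tu; rewrite /polarmx mulmxKV// absmx_unit. Qed.

Lemma polarmx_unitary T : T \in unitmx -> polarmx T \is unitarymx.
Proof.
move=> Tu; have Pu := absmx_unit Tu.
rewrite -trmxC_unitary; apply/unitarymxP; rewrite trmxCK /polarmx adjmxM.
(* Writing [P] for [absmx T], replace [T^* T] by [P P]; one [P] cancels against each inverse. *)
rewrite mulmxA -(mulmxA _ (T^t*)) -absmx_sqr mulmxA mulmxK//.
by rewrite -{2}(gram_adj (gram_absmx T)) -adjmxM mulmxV// adjmx1.
Qed.

(** Here [T^* T] is [P^2], and the square root undoes the square because the eigenvalues of [P] are
    nonnegative. This is uniqueness of the polar decomposition, needed to read off the factors of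
    each iterate. *)
Lemma absmx_unitary_mul U P : U \is unitarymx -> gram P -> absmx (U *m P) = P.
Proof.
move=> Uu gP; rewrite /absmx adjmxM mulmxA mulmxKtV//.
have nPP : P *m P \is normalmx.
  by apply/selfadj_normal; rewrite adjmxM (gram_adj gP).
rewrite (gram_adj gP) mxfunE; move: nPP.
rewrite (spectral_fun_sqr (gram_normal gP)) => /spectral_fun_comp ->.
transitivity (spectral_fun id P); last exact: spectral_fun_id (gram_normal gP).
apply: eq_spectral_fun => j; have := gram_spectral_diag_ge0 j gP.
case: (spectral_diag P 0 j) => a b; rewrite lecE => /andP[/eqP /= -> a_ge0].
by rewrite mulr0 subr0 -expr2 sqrtr_sqr ger0_norm.
Qed.

Lemma polarmx_unitary_mul U P : U \is unitarymx -> gram P -> P \in unitmx ->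
  polarmx (U *m P) = U.
Proof. by move=> Uu gP Pu; rewrite /polarmx absmx_unitary_mul// mulmxK. Qed.

(* [m_f(U^* P U, P)]. The first matrix has the same spectrum as [P]. *)
Definition mean_mx (f : R -> R) U P : 'M[R[i]]_n :=
  joint (mxspec P) (fun s => conjmxU U (spectral_proj P s)) (spectral_proj P)
    (fun s t => (s * f (t / s))%:C).

Lemma aluthge_polar f U P : U \is unitarymx -> gram P -> P \in unitmx ->
  aluthge f (U *m P) = U *m mean_mx f U P.
Proof.
move=> Uu gP Pu.
rewrite /mean_mx (mul_joint_conj _ _ _ Uu) /aluthge.
by rewrite (absmx_unitary_mul Uu gP) (polarmx_unitary_mul Uu gP Pu).
Qed.

Lemma orbit_commutes_spectral_proj U P j k s t : U \is unitarymx -> gram P ->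
  orbit_commutes U P ->
  comm_mx (conjmxU (U ^+ j) (spectral_proj P s))
          (conjmxU (U ^+ k) (spectral_proj P t)).
Proof.
move=> Uu gP UP; rewrite /spectral_proj !mxfunE.
exact: orbit_commutes_spectral_fun (gram_normal gP) UP.
Qed.

Lemma orbit_commutes_mean f U P : U \is unitarymx -> gram P ->
  orbit_commutes U P -> orbit_commutes U (mean_mx f U P).
Proof.
move=> Uu gP UP; apply: (orbit_commutes_joint _ _ Uu) => j k s t.
exact: (orbit_commutes_spectral_proj j k s t Uu gP UP).
Qed.

(** Through the joint calculus of [U^* P U] and [P], all three claims become scalar facts about
    eigenvalues [s, t > 0]: [s f(t/s)] is positive, and is at most [(1 - lam) s + lam t]. *)
Lemma mean_mx_step f lam U P : U \is unitarymx -> gram P -> P \in unitmx ->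
  orbit_commutes U P -> (forall x, 0 < x -> 0 < f x) ->
  (forall x, 0 < x -> f x <= 1 - lam + lam * x) ->
  [/\ gram (mean_mx f U P), mean_mx f U P \in unitmx &
      gram ((1 - lam)%:C *: conjmxU U P + lam%:C *: P - mean_mx f U P)].
Proof.
move=> Uu gP Pu UP f_gt0 f_le.
set l := mxspec P; set F := spectral_proj P.
have l_gt0 s : s \in l -> 0 < s by exact: mxspec_gram_gt0.
have l_uniq : uniq l by exact: undup_uniq.
have resF : resolution l F by exact: spectral_proj_resolution.
have resE := resolution_conj Uu resF.
have EF s t : comm_mx (conjmxU U (F s)) (F t).
  have := @orbit_commutes_spectral_proj U P 1 0 s t Uu gP UP.
  by rewrite expr0 expr1 [conjmxU 1 _]/conjmxU adjmx1 mul1mx mulmx1.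
have g_gt0 : {in l &, forall s t, 0 < (s * f (t / s))%:C}.
  move=> s t sl tl; rewrite (ltcR 0); apply: mulr_gt0; first exact: l_gt0.
  by apply/f_gt0/divr_gt0; exact: l_gt0.
split.
- by apply: gram_joint => // s t sl tl; rewrite ltW ?g_gt0.
- by apply: joint_unitmx => // s t sl tl; rewrite gt_eqF ?g_gt0.
have F_sum : \sum_(s <- l) s%:C *: F s = P.
  by rewrite (spectral_proj_sum id) mxfun_id// (gram_adj gP).
pose E s := conjmxU U (F s).
(* [U^* P U] and [P] are the two coordinate functions of the joint calculus; the dummy factor [1]
   gives them the product shape of [joint_prod]. *)
have UPE : conjmxU U P = joint l E F (fun s _ => s%:C * 1).
  rewrite (joint_prod _ _ _ (fun s => s%:C) (fun=> 1)).
  under [X in _ *m X]eq_bigr do rewrite scale1r.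
  case: resF => _ _ ->; rewrite mulmx1 -{1}F_sum conjmxU_sum.
  by apply: eq_bigr => s _; rewrite conjmxUZ.
have PE : P = joint l E F (fun _ t => 1 * t%:C).
  rewrite (joint_prod _ _ _ (fun=> 1) (fun t => t%:C)).
  under [X in X *m _]eq_bigr do rewrite scale1r.
  by case: resE => _ _ ->; rewrite mul1mx F_sum.
rewrite UPE [in lam%:C *: P]PE -!jointZ -jointD -jointN -jointD.
apply: gram_joint => // s t sl tl.
have s_gt0 := l_gt0 _ sl; have := f_le _ (divr_gt0 (l_gt0 _ tl) s_gt0).
rewrite mulr1 mul1r -!rmorphM -rmorphD -rmorphB ler0c subr_ge0 => f_ts.
rewrite (le_trans (ler_wpM2l (ltW s_gt0) f_ts))//.
by rewrite mulrDr (mulrC s) lerD2l mulrCA [s * _]mulrC divfK ?gt_eqF.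
Qed.

End AluthgeStep.

(** * Convergence *)

Lemma cvg_mx_entries (V : puniformType) m n (u : nat -> 'M[V]_(m, n))
    (L : 'M[V]_(m, n)) :
  (forall i j, (fun k => u k i j) @ \oo --> L i j) -> u @ \oo --> L.
Proof.
move=> uL; apply/cvg_mx_entourageP => A entA.
(* There are finitely many entries, so their eventual conditions hold simultaneously. *)
apply: filter_forall => i; apply: filter_forall => j.
have /cvg_entourageP/(_ A entA) uLA := uL i j.
change (\forall k \near \oo, (L i j, u k i j) \in A).
by near=> k; rewrite inE; near: k; exact: uLA.
Unshelve. all: by end_near.
Qed.

Lemma cvg_mulmx_entries (K : numFieldType) m n p q (A : 'M[K]_(m, n))
    (B : 'M[K]_(p, q)) (Y : nat -> 'M[K]_(n, p)) (L : 'M[K]_(n, p)) :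
  (forall i j, (fun k => Y k i j : K^o) @ \oo --> (L i j : K^o)) ->
  forall i j, (fun k => (A *m Y k *m B) i j : K^o) @ \oo -->
              ((A *m L *m B) i j : K^o).
Proof.
move=> YL i j.
have mulE (X : 'M[K]_(n, p)) : (A *m X *m B) i j =
    \sum_k \sum_h A i h * X h k * B k j.
  by rewrite mxE; apply: eq_bigr => k _; rewrite mxE mulr_suml.
rewrite mulE; under eq_fun do rewrite mulE.
apply: cvg_big => [|k _]; first exact: add_continuous.
apply: cvg_big => [|h _]; first exact: add_continuous.
by apply: cvgM; [apply: cvgM; [exact: cvg_cst|exact: YL]|exact: cvg_cst].
Qed.

Lemma cvg_conjC (C : numClosedFieldType) (y : nat -> C) (l : C) :
  (y : nat -> C^o) @ \oo --> (l : C^o) ->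
  (fun n => Num.conj (y n) : C^o) @ \oo --> (Num.conj l : C^o).
Proof.
move=> /cvgrPdist_lt yl; apply/cvgrPdist_lt => e /yl yle.
by apply: filterS yle => n; rewrite -rmorphB norm_conjC.
Qed.

(** The conjugate of entry [(j, i)] and the entry [(i, j)] are the same sequence, so their limits
    agree by uniqueness. *)
Lemma cvg_selfadj_entries (C : numClosedFieldType) n (Y : nat -> 'M[C]_n)
    (L : 'M[C]_n) :
  (forall i j, (fun k => Y k i j : C^o) @ \oo --> (L i j : C^o)) ->
  (forall k, (Y k)^t* = Y k) -> L^t* = L.
Proof.
move=> YL Yadj; apply/matrixP => i j; rewrite !mxE.
apply: (cvg_unique (@norm_hausdorff C C^o) _ (YL i j)).
have := cvg_conjC (YL j i).
suff -> : (fun k => Num.conj (Y k j i)) = (fun k => Y k i j) by [].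
by apply/funext => k; rewrite -[in RHS]Yadj !mxE.
Qed.

Lemma unitary_diag_norm (C : numClosedFieldType) n (d : 'rV[C]_n) j :
  diag_mx d \is unitarymx -> `|d 0 j| = 1.
Proof.
move=> /unitarymxP /matrixP /(_ j j).
rewrite mul_diag_mx !mxE eqxx mulr1n -normCK => /eqP.
by rewrite sqrp_eq1// => /eqP.
Qed.

Lemma conjmxU_diag (C : numClosedFieldType) n (d : 'rV[C]_n) (A : 'M[C]_n) i j :
  conjmxU (diag_mx d) A i j = Num.conj (d 0 i) * d 0 j * A i j.
Proof.
rewrite /conjmxU tr_diag_mx map_diag_mx mul_diag_mx mul_mx_diag !mxE.
by rewrite mulrAC.
Qed.

Lemma conjmxU_change_basis (C : numClosedFieldType) n (A D W : 'M[C]_n) :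
  W \is unitarymx -> conjmxU D (conjmxU (W^t*) A) =
    conjmxU (W^t*) (conjmxU (conjmxU W D) A).
Proof.
move=> Wu; rewrite !conjmxU_mul; congr (conjmxU _ _).
by rewrite /conjmxU mulmxtVK.
Qed.

Lemma comm_conjmxU (C : numClosedFieldType) n (A B W : 'M[C]_n) :
  W \is unitarymx -> comm_mx A B -> comm_mx (conjmxU W A) (conjmxU W B).
Proof. by move=> Wu AB; rewrite /comm_mx -!conjmxUM// AB. Qed.

Lemma unitary_diagonalisation (C : numClosedFieldType) n (U : 'M[C]_n) :
  U \is unitarymx -> exists (W : 'M[C]_n) (d : 'rV[C]_n),
  [/\ W \is unitarymx, U = conjmxU W (diag_mx d) & forall j, `|d 0 j| = 1].
Proof.
move=> Uu; have nU : U \is normalmx.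
  by apply/normalmxP; rewrite (unitarymxP Uu) unitarymx_adjM.
have Wu := spectral_unitarymx U; have specU := normal_spectralE nU.
exists (spectralmx U), (spectral_diag U); split=> // j.
apply: unitary_diag_norm; rewrite -(conjmxUKV (diag_mx _) Wu) -specU.
by rewrite /conjmxU !mul_unitarymx ?trmxC_unitary.
Qed.

Lemma cvg_damped_conjugation_diag (R : realType) n (lam : R)
    (d : 'rV[R[i]]_n) (P : nat -> 'M[R[i]]_n) i j :
  0 < lam < 1 -> (forall j, `|d 0 j| = 1) -> (forall k, gram (P k)) ->
  (forall k, gram ((1 - lam)%:C *: conjmxU (diag_mx d) (P k) + lam%:C *: P k
                   - P k.+1)) ->
  exists2 l : R[i], (fun k => P k i j : (R[i])^o) @ \oo --> (l : (R[i])^o) &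
    Num.conj (d 0 i) * d 0 j * l = l.
Proof.
move=> lam01 d1 gP gPS.
pose z i j := Num.conj (d 0 i) * d 0 j.
have z_diag h : z h h = 1 by rewrite /z mulrC -normCK d1 expr1n.
pose e k := (1 - lam)%:C *: conjmxU (diag_mx d) (P k) + lam%:C *: P k - P k.+1.
have eE k h h' : e k h h' =
    ((1 - lam)%:C * z h h' + lam%:C) * P k h h' - P k.+1 h h'.
  rewrite /e; set Z := conjmxU _ _; have ZE : Z h h' = z h h' * P k h h'.
    exact: conjmxU_diag.
  by clearbody Z; rewrite !mxE ZE mulrDl mulrA.
(* On the diagonal the rotation factor is [|d_h|^2 = 1], so the error is a plain decrement. *)
have e_diag k h : e k h h = P k h h - P k.+1 h h.
  by rewrite eE z_diag mulr1 -rmorphD subrK mul1r.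
have Re_diag k h : (complex.Re (P k h h))%:C = P k h h.
  by rewrite RRe_real// ger0_real// gram_diag_ge0.
(* The controlling sequence is the mean of the diagonal entries at [i] and [j]: its decrement is
   [(e_ii + e_jj) / 2], which dominates [|e_ij|]. *)
apply: (@cvgn_perturbed_rotation _ lam _ _
  (fun k => (complex.Re (P k i i) + complex.Re (P k j j)) / 2)) => //.
- by rewrite normrM norm_conjC !d1 mulr1.
- move=> k; rewrite divr_ge0// addr_ge0// -ler0c Re_diag.
    exact: gram_diag_ge0.
  exact: gram_diag_ge0.
move=> k; rewrite -normrN opprB -eE (le_trans (gram_offdiag _ _ (gPS k)))//.
rewrite -/(e k) !e_diag -mulrBl rmorphM fmorphV rmorph_nat.
rewrite rmorphB !rmorphD /= !Re_diag.
by rewrite opprD addrACA.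
Qed.

Lemma cvg_damped_conjugation (R : realType) n (lam : R) (U : 'M[R[i]]_n)
    (P : nat -> 'M[R[i]]_n) :
  0 < lam < 1 -> U \is unitarymx -> (forall k, gram (P k)) ->
  (forall k, gram ((1 - lam)%:C *: conjmxU U (P k) + lam%:C *: P k - P k.+1)) ->
  exists L : 'M[R[i]]_n, [/\ L^t* = L, comm_mx U L &
    forall i j, (fun k => P k i j : (R[i])^o) @ \oo --> (L i j : (R[i])^o)].
Proof.
move=> lam01 Uu gP gPS.
have [W [d [Wu UE d1]]] := unitary_diagonalisation Uu.
(* [Y k] is [P k] in an eigenbasis of [U]. The change of basis is unitary, so it preserves both the
   Gram property and the recurrence. *)
pose Y k := conjmxU (W^t*) (P k).
have gY k : gram (Y k) by exact: gram_conj.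
have gYS k : gram ((1 - lam)%:C *: conjmxU (diag_mx d) (Y k) + lam%:C *: Y k
                   - Y k.+1).
  suff -> : (1 - lam)%:C *: conjmxU (diag_mx d) (Y k) + lam%:C *: Y k - Y k.+1
    = conjmxU (W^t*) ((1 - lam)%:C *: conjmxU U (P k) + lam%:C *: P k - P k.+1).
    exact: gram_conj.
  have -> : conjmxU (diag_mx d) (Y k) = conjmxU (W^t*) (conjmxU U (P k)).
    by rewrite UE; exact: conjmxU_change_basis.
  by rewrite /Y -!conjmxUZ -conjmxUD -conjmxUN -conjmxUD.
have Ycvg i j := cvg_damped_conjugation_diag i j lam01 d1 gY gYS.
pose D := \matrix_(i, j) sval (cid2 (Ycvg i j)).
have YD i j : (fun k => Y k i j : (R[i])^o) @ \oo --> (D i j : (R[i])^o).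
  by rewrite mxE; case: cid2.
(* Multiplying [conj(d_i) d_j l = l] by [d_i], of modulus one, gives [d_j l = d_i l], which is
   commutation at entry [(i, j)]. *)
have dD : comm_mx (diag_mx d) D.
  rewrite /comm_mx mul_diag_mx mul_mx_diag; apply/matrixP => i j; rewrite !mxE.
  case: cid2 => l /= _ lE.
  by rewrite -[in LHS]lE !mulrA -normCK d1 expr1n mul1r mulrC.
have PE k : P k = W^t* *m Y k *m W by rewrite -[P k](conjmxUK _ Wu).
have PL i j : (fun k => P k i j : (R[i])^o) @ \oo -->
    (conjmxU W D i j : (R[i])^o).
  under eq_fun do rewrite PE; exact: cvg_mulmx_entries.
exists (conjmxU W D); split; last exact: PL.
  by apply: cvg_selfadj_entries PL _ => k; exact: gram_adj.
by rewrite UE; exact: comm_conjmxU.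
Qed.

Lemma unitary_mul_selfadj_normal (C : numClosedFieldType) n (U L : 'M[C]_n) :
  U \is unitarymx -> L^t* = L -> comm_mx U L -> U *m L \is normalmx.
Proof.
move=> Uu adjL UL; apply/normalmxP.
(* Both products of [U L] with its adjoint equal [L^2]: one by commutation, the other by
   [U^* U = 1]. *)
rewrite adjmxM adjL; transitivity (L *m L).
  by rewrite !mulmxA UL -(mulmxA L) UL mulmxA mulmxtVK.
by rewrite mulmxA mulmxKtV.
Qed.

Lemma adjmxX (C : numClosedFieldType) n (U : 'M[C]_n) k :
  (U ^+ k)^t* = U^t* ^+ k.
Proof.
elim: k => [|k IHk]; first exact: adjmx1.
by rewrite exprS exprSr -IHk; exact: adjmxM.
Qed.

Lemma centered_orbit_commutes (R : realType) n (T : 'M[R[i]]_n) :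
  centered T -> orbit_commutes (polarmx T) (absmx T).
Proof.
move=> cT; suff orbit_in k :
    centered_family T (conjmxU (polarmx T ^+ k) (absmx T)).
  by move=> j k; apply: cT.
(* The exponent [0] is the separate member [absmx T] of the family, whose conjugates have positive
   exponents. *)
rewrite /conjmxU adjmxX; case: k => [|k]; last by apply: Or31; exists k.+1.
by apply: Or32; rewrite !expr0 mul1mx mulmx1.
Qed.

Theorem theorem4p1 (R : realType) (m : nat) (T : 'M[R[i]]_m)
    (hT : T \in unitmx) (hcent : centered T)
    (f : R -> R) (hf : representing_function f)
    (lam : R) (hlam : lam = derive1 f 1) (hlam01 : 0 < lam < 1)
    (hle : forall x : R, 0 < x -> f x <= 1 - lam + lam * x) :
  exists L : 'M[R[i]]_m, L \is normalmx /\
    (fun n : nat => iter n (aluthge f) T : 'M[(R[i])^o]_m) @ \oo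
      --> (L : 'M[(R[i])^o]_m).
Proof.
have [f_gt0 _ _] := hf.
set U := polarmx T; have Uu : U \is unitarymx by exact: polarmx_unitary.
(* The unitary factor is frozen at that of [T]; only the positive factor is iterated. *)
pose P n := iter n (mean_mx f U) (absmx T).
have inv n : [/\ gram (P n), P n \in unitmx & orbit_commutes U (P n)].
  elim: n => [|n [gP Pu UP]].
    split; [exact: gram_absmx|exact: absmx_unit|exact: centered_orbit_commutes].
  have [gPS PSu _] := mean_mx_step Uu gP Pu UP f_gt0 hle.
  by split=> //; exact: orbit_commutes_mean.
have iterE n : iter n (aluthge f) T = U *m P n.
  elim: n => [|n IHn]; first exact: polar_decomposition.
  by have [gP Pu _] := inv n; rewrite iterS IHn (aluthge_polar f Uu gP Pu).
have gP n : gram (P n) by case: (inv n).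
have gPS n :
    gram ((1 - lam)%:C *: conjmxU U (P n) + lam%:C *: P n - P n.+1).
  by have [gPn Pu UP] := inv n; case: (mean_mx_step Uu gPn Pu UP f_gt0 hle).
have [L [adjL UL PL]] := cvg_damped_conjugation hlam01 Uu gP gPS.
exists (U *m L); split; first exact: unitary_mul_selfadj_normal.
apply: cvg_mx_entries => i j.
(* A trivial right factor gives the two-sided product whose entrywise continuity is known. *)
under eq_fun do rewrite iterE -[U *m _]mulmx1.
rewrite -[U *m L]mulmx1.
exact: cvg_mulmx_entries.
Qed.
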